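(* Let $\mathfrak{g}$ be a simple, simply-laced Lie algebra of rank $r$, and for $k\in\mathbb{Z}$ let $\mathbf{x}_k=(\widetilde{Q}_{1,2k},\dots,\widetilde{Q}_{r,2k},\widetilde{Q}_{1,2k+1},\dots,\widetilde{Q}_{r,2k+1})$ be the cluster at node $k$ of the cluster algebra corresponding to the $Q$-system of $\mathfrak{g}$. Then in the limit $Q_{\alpha,0}\to 1$ for all $\alpha\in\{1,\dots,r\}$ (that is, $\widetilde{Q}_{\alpha,0}\to\epsilon_\alpha$, a root of unity), the cluster variables at any node $k>0$ are polynomials (with complex coefficients) in the cluster variables of the node $k=0$. (In this limit the cluster variables of node $0$ are the constants $\widetilde{Q}_{\alpha,0}=\epsilon_\alpha$ together with the indeterminates $\widetilde{Q}_{\alpha,1}$, $\alpha\in\{1,\dots,r\}$.)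
   Context: Let $C$ be the Cartan matrix of $\mathfrak{g}$, $I_r=\{1,\dots,r\}$ the set of nodes of its Dynkin diagram, and write $\beta\sim\alpha$ if $\beta$ and $\alpha$ are distinct adjacent nodes. The variables $Q_{\alpha,k}$ ($\alpha\in I_r$, $k\in\mathbb{Z}$) are elements of the field of rational functions over $\mathbb{C}$ in the $2r$ algebraically independent indeterminates $Q_{\alpha,0},Q_{\alpha,1}$ ($\alpha\in I_r$), determined by the recursion $$Q_{\alpha,k+1}=Q_{\alpha,k-1}^{-1}\Bigl(Q_{\alpha,k}^2-\prod_{\beta\sim\alpha}Q_{\beta,k}\Bigr)\qquad(\alpha\in I_r,\ k\in\mathbb{Z}),$$ used in both directions of $k$. Fix nonzero complex numbers $\epsilon_\alpha$ with $\prod_{\beta\in I_r}\epsilon_\beta^{C_{\alpha,\beta}}=-1$ for all $\alpha\in I_r$ (for example $\epsilon_\beta=\exp(i\pi\sum_\alpha (C^{-1})_{\beta,\alpha})$; any such $\epsilon_\alpha$ are roots of unity), and set $\widetilde{Q}_{\alpha,k}=\epsilon_\alpha Q_{\alpha,k}$, so that $$\widetilde{Q}_{\alpha,k+1}=\widetilde{Q}_{\alpha,k-1}^{-1}\Bigl(\widetilde{Q}_{\alpha,k}^2+\prod_{\beta\sim\alpha}\widetilde{Q}_{\beta,k}\Bigr).$$ The cluster algebra is the (coefficient-free) one of rank $2r$ with initial seed $(\mathbf{x}_0,B)$, $B=\begin{pmatrix}0&-C\\ C&0\end{pmatrix}$; the $\mathbf{x}_k$, $k\in\mathbb{Z}$,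 are clusters of it. By the Laurent phenomenon every cluster variable is a Laurent polynomial in the entries of $\mathbf{x}_0$; ''the limit $Q_{\alpha,0}\to 1$'' means substituting $Q_{\alpha,0}=1$ for all $\alpha$ (equivalently $\widetilde{Q}_{\alpha,0}=\epsilon_\alpha$) into these Laurent polynomials, keeping $Q_{\alpha,1}$ as indeterminates. *)

(* Defs.v *)
From HB Require Import structures.
From mathcomp Require Import all_boot all_order all_algebra fraction.
From mathcomp Require Import reals complex.
From mathcomp Require Import mpoly.

Set Implicit Arguments.
Unset Strict Implicit.
Unset Printing Implicit Defensive.

Import Order.TTheory GRing.Theory Num.Theory.
Local Open Scope ring_scope.

Section LieAlgebra.
Variables (K : fieldType) (g : vectType K) (br : g -> g -> g).

Definition lie_bracket : Prop :=
  [/\ forall (a : K) x y z, br (a *: x + y) z = a *: br x z + br y z,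
      forall (a : K) x y z, br z (a *: x + y) = a *: br z x + br z y,
      forall x, br x x = 0
    & forall x y z, br x (br y z) + br y (br z x) + br z (br x y) = 0].

Definition lie_ideal (I : {vspace g}) : Prop :=
  forall x y, y \in I -> br x y \in I.

Definition simple_lie : Prop :=
  (exists x y, br x y != 0) /\
  (forall I : {vspace g}, lie_ideal I -> I = 0%VS \/ I = fullv).

(* A nilpotent, self-normalizing subalgebra. *)
Definition cartan_subalgebra (H : {vspace g}) : Prop :=
  [/\ forall x y, x \in H -> y \in H -> br x y \in H,
      exists n, forall (s : n.-tuple g) y,
        {subset s <= H} -> y \in H -> foldr br y s = 0
    & forall x, (forall y, y \in H -> br x y \in H) -> x \in H].

Section Roots.
Variable H : {vspace g}.

Notation dual := 'Hom(subvs_of H, K^o).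

Definition weight_vector (lam : dual) (x : g) : Prop :=
  forall h : subvs_of H, br (vsval h) x = (lam h : K) *: x.

Definition is_root (lam : dual) : Prop :=
  lam != 0 /\ (exists2 x, x != 0 & weight_vector lam x).

Definition simple_roots (r : nat) (alpha : 'I_r -> dual) : Prop :=
  [/\ forall i, is_root (alpha i),
      basis_of fullv [seq alpha i | i : 'I_r]
    & forall lam, is_root lam -> exists c : 'I_r -> nat,
        lam = \sum_i alpha i *+ c i \/ lam = - \sum_i alpha i *+ c i].

Definition is_coroot (lam : dual) (h : subvs_of H) : Prop :=
  lam h = 2 /\
  (exists e f, [/\ weight_vector lam e, weight_vector (- lam) f
                 & br e f = vsval h]).

End Roots.

(* The entry C i j is the value of the simple root alpha_j on the coroot of
   alpha_i.  The existence of a basis of simple roots indexed by 'I_r also says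
   that the rank of g is r. *)
Definition cartan_matrix (r : nat) (C : 'M[int]_r) : Prop :=
  exists (H : {vspace g}) (alpha : 'I_r -> 'Hom(subvs_of H, K^o))
         (h : 'I_r -> subvs_of H),
    [/\ cartan_subalgebra H, simple_roots alpha,
        forall i, is_coroot (alpha i) (h i)
      & forall i j, alpha j (h i) = (C i j)%:~R].

End LieAlgebra.

Definition simply_laced (r : nat) (C : 'M[int]_r) : Prop :=
  C^T = C /\ (forall i j, i != j -> C i j = 0 \/ C i j = -1).

Definition adjacent (r : nat) (C : 'M[int]_r) : rel 'I_r :=
  fun a b => (b != a) && (C a b != 0).

Section ClusterAlgebra.
Variables (F : fieldType) (n : nat).

Definition seed : Type := ('rV[F]_n * 'M[int]_n)%type.

Definition pos_part (z : int) : nat := absz (Num.max 0 z).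

Definition mutate_matrix (l : 'I_n) (B : 'M[int]_n) : 'M[int]_n :=
  \matrix_(i, j) (if (i == l) || (j == l) then - B i j
    else B i j + Num.sg (B i l) * Num.max 0 (B i l * B l j)).

Definition mutate_cluster (l : 'I_n) (B : 'M[int]_n) (x : 'rV[F]_n) : 'rV[F]_n :=
  \row_j (if j == l then
      (x 0 l)^-1 * (\prod_i x 0 i ^+ pos_part (B i l)
                    + \prod_i x 0 i ^+ pos_part (- B i l))
    else x 0 j).

Definition mutate (s : seed) (l : 'I_n) : seed :=
  (mutate_cluster l s.2 s.1, mutate_matrix l s.2).

Definition is_cluster (s0 : seed) (x : 'rV[F]_n) : Prop :=
  exists w : seq 'I_n, (foldl mutate s0 w).1 = x.

End ClusterAlgebra.

(* Rational functions over K in 2r indeterminates: the first r of them are the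
   Q_{a,0}, the last r are the Q_{a,1}. *)
Notation ratfun K r := {fraction {mpoly K[(r + r)%N]}}.

Section QSystem.
Variables (K : fieldType) (r : nat) (C : 'M[int]_r).

Definition scalar (c : K) : ratfun K r := FracField.tofrac c%:MP.

Definition indet (j : 'I_(r + r)) : ratfun K r := FracField.tofrac 'X_j.

Definition indet0 (a : 'I_r) : ratfun K r := indet (lshift r a).
Definition indet1 (a : 'I_r) : ratfun K r := indet (rshift r a).

Definition qsys_next (u v : 'I_r -> ratfun K r) (a : 'I_r) : ratfun K r :=
  (u a)^-1 * (v a ^+ 2 - \prod_(b | adjacent C a b) v b).

(* A pair (u, v) stands for two consecutive families (Q_k, Q_{k+1}). *)
Definition qsys_fwd (p : ('I_r -> ratfun K r) * ('I_r -> ratfun K r)) :=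
  (p.2, qsys_next p.1 p.2).
Definition qsys_bwd (p : ('I_r -> ratfun K r) * ('I_r -> ratfun K r)) :=
  (qsys_next p.2 p.1, p.1).

Definition qsys_pair (k : int) :=
  match k with
  | Posz m => iter m qsys_fwd (indet0, indet1)
  | Negz m => iter m.+1 qsys_bwd (indet0, indet1)
  end.

Definition Q (a : 'I_r) (k : int) : ratfun K r := (qsys_pair k).1 a.

Variable eps : 'I_r -> K.

Definition Qt (a : 'I_r) (k : int) : ratfun K r := scalar (eps a) * Q a k.

Definition node (k : int) : 'rV[ratfun K r]_(r + r) :=
  row_mx (\row_a Qt a (k *+ 2)) (\row_a Qt a (k *+ 2 + 1)).

Definition initial_seed : seed (ratfun K r) (r + r) :=
  (node 0, block_mx 0 (- C) C 0).

Definition poly_eval (P : {mpoly K[(r + r)%N]})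
    (y : 'I_(r + r) -> ratfun K r) : ratfun K r := mmap scalar y P.

(* Value at y of the Laurent polynomial P / 'X_[m]. *)
Definition laurent_eval (P : {mpoly K[(r + r)%N]}) (m : 'X_{1..(r + r)%N})
    (y : 'I_(r + r) -> ratfun K r) : ratfun K r :=
  poly_eval P y / mmap1 y m.

Definition at_Q0_1 (j : 'I_(r + r)) : ratfun K r :=
  match split j with inl _ => 1 | inr a => indet1 a end.

(* [Q0_limit f f1]: f is a Laurent polynomial in the Q_{a,0}, Q_{a,1}, and f1 is
   obtained from it by substituting Q_{a,0} = 1 for all a.  The Laurent
   polynomial is determined by f since the indeterminates are algebraically
   independent, so f1 is unique.  As the eps a are nonzero constants, Laurent
   polynomials in the Q_{a,0}, Q_{a,1} are those in the entries of [node 0]. *)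
Definition Q0_limit (f f1 : ratfun K r) : Prop :=
  exists (P : {mpoly K[(r + r)%N]}) (m : 'X_{1..(r + r)%N}),
    f = laurent_eval P m indet /\ f1 = laurent_eval P m at_Q0_1.

Definition node0_limit : 'rV[ratfun K r]_(r + r) :=
  row_mx (\row_a scalar (eps a)) (\row_a Qt a 1).

End QSystem.

(* Main.v *)
Require Import Defs.
From HB Require Import structures.
From mathcomp Require Import all_boot all_order all_algebra fraction.
From mathcomp Require Import reals complex.
From mathcomp Require Import mpoly.
From mathcomp Require Import ring zify.
Import Order.TTheory GRing.Theory Num.Theory.
Local Open Scope ring_scope.

(* Put c_a = 1 - t_a v_a and start the recursion
     Q_{a,k+1} Q_{a,k-1} = Q_{a,k}^2 - c_a prod_{b ~ a} Q_{b,k}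
   at Q_{-1} = t, Q_0 = 1, Q_1 = v, with all the t_a, v_a independent.  Its
   solution F_k consists of polynomials in t and v: restarting at time 1 shows
   that only the v_a can occur in a denominator, restarting at time 2 that only
   the F_{b,2} can, and F_{b,2} does not vanish modulo the prime v_a.
   Up to rescaling, every solution of a recursion of this shape with constant
   c is a specialization of F, so the Q-system satisfies
     Q_{a,k} = Q_{a,0} F_{a,k}(Q_{b,-1} / Q_{b,0}, Q_{b,1} / Q_{b,0}).
   When Q_{b,0} -> 1 the numerator Q_{b,0}^2 - prod_{d ~ b} Q_{d,0} of Q_{b,-1}
   vanishes, which leaves the polynomial F_{a,k}(0, Q_1).  Consecutive nodes are
   related by mutating at all the nodes of one block, then of the other. *)

(** * Divisibility and denominators *)

(** Monomials are products of variables, so a property closed under sums and products need only be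
    checked on constants and single variables. *)
Lemma mpoly_ring_ind {n : nat} {K : nzRingType} (P : {mpoly K[n]} -> Prop) :
  (forall c, P c%:MP) -> (forall i, P 'X_i) ->
  (forall p q, P p -> P q -> P (p + q)) ->
  (forall p q, P p -> P q -> P (p * q)) -> forall p, P p.
Proof.
move=> PC PX PD PM; elim/mpolyind=> [|c m p _ _ Pp]; first exact: PC 0.
apply: (PD) Pp; rewrite -mul_mpolyC mpolyXE_id; apply: (PM) (PC c) _.
apply: big_ind => //; first exact: PC 1.
move=> i _; elim: (m i) => [|k IHk]; first exact: PC 1.
by rewrite exprS; apply: PM.
Qed.

(** Reduction modulo ['X_i], kept inside the same polynomial ring. *)
Definition zero_var {n : nat} {K : comNzRingType} (i : 'I_n) :
    {mpoly K[n]} -> {mpoly K[n]} :=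
  mmap (@mpolyC n K) (fun j => if j == i then 0 else 'X_j).

Lemma zero_var_ker {n : nat} {K : comNzRingType} (i : 'I_n) (p : {mpoly K[n]}) :
  zero_var i p = 0 -> exists q, p = 'X_i * q.
Proof.
move=> H0.
(* The induction needs this form, which holds for every [p]. *)
suff [q Hq]: exists q, p = zero_var i p + 'X_i * q.
  by exists q; rewrite {1}Hq H0 add0r.
elim/(@mpoly_ring_ind n K): p {H0} => [c|j|p q [p1 Hp] [q1 Hq]|p q [p1 Hp] [q1 Hq]].
- by exists 0; rewrite /zero_var mmapC mulr0 addr0.
- rewrite /zero_var mmapX mmap1U; case: eqP => [->|_].
    by exists 1; rewrite mulr1 add0r.
  by exists 0; rewrite mulr0 addr0.
- by exists (p1 + q1); rewrite {1}Hp {1}Hq /zero_var rmorphD /=; ring.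
- exists (zero_var i p * q1 + p1 * zero_var i q + 'X_i * p1 * q1).
  by rewrite {1}Hp {1}Hq /zero_var rmorphM /=; ring.
Qed.

Definition integral {A : idomainType} (f : {fraction A}) : Prop :=
  exists p : A, f = FracField.tofrac p.

Lemma integralD {A : idomainType} (f g : {fraction A}) :
  integral f -> integral g -> integral (f + g).
Proof. by move=> [p ->] [q ->]; exists (p + q); rewrite tofracD. Qed.

Lemma integralM {A : idomainType} (f g : {fraction A}) :
  integral f -> integral g -> integral (f * g).
Proof. by move=> [p ->] [q ->]; exists (p * q); rewrite tofracM. Qed.

Lemma integralX {A : idomainType} (f : {fraction A}) k :
  integral f -> integral (f ^+ k).
Proof. by move=> [p ->]; exists (p ^+ k); rewrite tofracXn. Qed.

(* [zero_var i d != 0] says that d is coprime to the prime 'X_i. *)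
Lemma integral_coprime_var {n : nat} {K : idomainType} (i : 'I_n)
    (d : {mpoly K[n]}) (f : {fraction {mpoly K[n]}}) :
  zero_var i d != 0 -> integral (FracField.tofrac 'X_i * f) ->
  integral (FracField.tofrac d * f) -> integral f.
Proof.
move=> d0 [p Hp] [q Hq].
have X0 : ('X_i : {mpoly K[n]}) != 0 by rewrite -msize_poly_eq0 msizeX.
have : d * p = 'X_i * q.
  by apply/eqP; rewrite -tofrac_eq !tofracM -Hp -Hq mulrCA.
move/(congr1 (zero_var i)); rewrite /zero_var !rmorphM /= mmapX mmap1U eqxx mul0r.
move/eqP; rewrite mulf_eq0 (negPf d0) /= => /eqP /zero_var_ker [p' Ep].
exists p'; apply: (@mulfI _ (FracField.tofrac 'X_i)).
  by rewrite tofrac_eq0.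
by rewrite Hp Ep tofracM.
Qed.

(** The variables are cancelled one at a time, down the list and then down the exponent [k].
    Multiplying [f] by a polynomial keeps [d * f] integral, so the hypothesis on [d] survives. *)
Lemma integral_coprime_monomial {n : nat} {K : idomainType} {I : Type}
    (s : seq I) (i : I -> 'I_n) (k : nat)
    (d : {mpoly K[n]}) (f : {fraction {mpoly K[n]}}) :
  (forall a, zero_var (i a) d != 0) ->
  integral (FracField.tofrac (\prod_(a <- s) 'X_(i a)) ^+ k * f) ->
  integral (FracField.tofrac d * f) -> integral f.
Proof.
move=> d0.
have dM (p : {mpoly K[n]}) g : integral (FracField.tofrac d * g) ->
    integral (FracField.tofrac d * (FracField.tofrac p * g)).
  by move=> Hg; rewrite mulrCA; apply: integralM Hg; exists p.
have Hs g : integral (FracField.tofrac (\prod_(a <- s) 'X_(i a)) * g) ->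
    integral (FracField.tofrac d * g) -> integral g.
  elim: s g => [|a s IHs] g; first by rewrite big_nil tofrac1 mul1r.
  rewrite big_cons tofracM -mulrA => Hg dg; apply: (IHs) (dg).
  by apply: integral_coprime_var (d0 a) Hg _; apply: dM.
elim: k f => [|k IHk] f; first by rewrite expr0 mul1r.
rewrite exprS -mulrA => Hf df; apply: (IHk) (df).
by apply: Hs Hf _; rewrite -tofracXn; apply: dM.
Qed.

(** Every argument [z j] has denominator [d], so [k] only has to bound the degree of [p]. *)
Lemma integral_mmap {A : idomainType} {n : nat} {K : comNzRingType}
    (h : {rmorphism K -> A}) (d : {fraction A}) (z : 'I_n -> {fraction A})
    (p : {mpoly K[n]}) :
  integral d -> (forall j, integral (d * z j)) ->
  exists k, integral (d ^+ k * mmap (@FracField.tofrac A \o h) z p).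
Proof.
move=> Hd Hz; elim/(@mpoly_ring_ind n K): p => [c|j|p q [k Hp] [l Hq]|p q [k Hp] [l Hq]].
- by exists 0%N; rewrite expr0 mul1r mmapC; eexists.
- by exists 1%N; rewrite expr1 mmapX mmap1U.
- exists (k + l)%N; rewrite rmorphD mulrDr exprD {1}[d ^+ k * _]mulrC -!mulrA.
  by apply: integralD; apply: integralM => //; apply: integralX.
- by exists (k + l)%N; rewrite rmorphM exprD mulrACA; apply: integralM.
Qed.

(** * The universal solution *)

Definition qsys_rel {r : nat} {E : comNzRingType} (e : rel 'I_r) (c : 'I_r -> E)
    (N : nat) (Q : nat -> 'I_r -> E) : Prop :=
  forall m a, (m.+1 < N)%N ->
    Q m.+2 a * Q m a = Q m.+1 a ^+ 2 - c a * \prod_(b | e a b) Q m.+1 b.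

Definition prev_var {r : nat} {K : nzRingType} (a : 'I_r) : {mpoly K[(r + r)%N]} :=
  'X_(lshift r a).
Definition next_var {r : nat} {K : nzRingType} (a : 'I_r) : {mpoly K[(r + r)%N]} :=
  'X_(rshift r a).

(* At this point 1 - t v = -1, so that the recursion becomes subtraction-free. *)
Definition qpoint {r : nat} {K : nzRingType} (j : 'I_(r + r)) : K :=
  match split j with inl _ => 2 | inr _ => 1 end.

Lemma split_lshift {r : nat} (a : 'I_r) : split (lshift r a) = inl a.
Proof. exact: (unsplitK (inl _ a)). Qed.

Lemma split_rshift {r : nat} (a : 'I_r) : split (rshift r a) = inr a.
Proof. exact: (unsplitK (inr _ a)). Qed.

(* The positivity clause is an induction invariant ensuring F m a != 0. *)
Definition qpolys {r : nat} {K : numFieldType} (e : rel 'I_r) (N : nat)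
    (F : nat -> 'I_r -> {mpoly K[(r + r)%N]}) : Prop :=
  [/\ forall a, F 0%N a = 1, forall a, F 1%N a = next_var a,
      qsys_rel e (fun a => 1 - prev_var a * next_var a) N F
    & forall m a, (m <= N)%N -> 0 < (F m a).@[qpoint]].

(** Dividing by the values at time 0 gives a recursion with constant [c a * \prod_(b | e a b) Q 0 b
    / Q 0 a ^+ 2], which is 1 - t v evaluated at [z]; here [t a] plays the value at time -1. The
    last term [Q N] may vanish, since nothing is divided by it. *)
Lemma qsys_qpolys {r : nat} {K : numFieldType} {E : fieldType}
    (h : {rmorphism K -> E}) (e : rel 'I_r) (N : nat)
    (F : nat -> 'I_r -> {mpoly K[(r + r)%N]})
    (c t : 'I_r -> E) (Q : nat -> 'I_r -> E) (z : 'I_(r + r) -> E) :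
  qpolys e N F -> qsys_rel e c N Q -> (forall m a, (m < N)%N -> Q m a != 0) ->
  (forall a, t a * Q 1%N a = Q 0%N a ^+ 2 - c a * \prod_(b | e a b) Q 0%N b) ->
  (forall a, z (lshift r a) = t a / Q 0%N a) ->
  (forall a, z (rshift r a) = Q 1%N a / Q 0%N a) ->
  (0 < N)%N -> forall m a, (m <= N)%N -> Q m a = Q 0%N a * mmap h z (F m a).
Proof.
move=> [F0 F1 Frec _] Qrec Qn0 Qt zl zr N_gt0.
have Q0n0 a : Q 0%N a != 0 by apply: Qn0.
suff H m : ((m <= N)%N -> forall a, Q m a = Q 0%N a * mmap h z (F m a)) /\
           ((m < N)%N -> forall a, Q m.+1 a = Q 0%N a * mmap h z (F m.+1 a)).
  by move=> m a le_mN; apply: (H m).1.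
elim: m => [|m [IH0 IH1]]; split=> //.
- by move=> _ a; rewrite F0 rmorph1 mulr1.
- by move=> _ a; rewrite F1 mmapX mmap1U zr mulrC divfK.
move=> lt_mN a; have Em := IH0 (ltnW (ltnW lt_mN)) a; have Em1 := IH1 (ltnW lt_mN).
have Qm0 : Q m a != 0 by apply: Qn0; apply: ltnW.
apply: (mulIf Qm0); rewrite Qrec // Em mulrACA -rmorphM Frec //.
rewrite rmorphB rmorphXn rmorphM rmorphB rmorph1 rmorphM /= rmorph_prod /=.
rewrite !mmapX !mmap1U zl zr Em1 (eq_bigr _ (fun b _ => Em1 b)) big_split /=.
rewrite mulrA -[c a * _](addKr (Q 0%N a ^+ 2)) -/(_ - _).
have -> : c a * \prod_(b | e a b) Q 0%N b = Q 0%N a ^+ 2 - t a * Q 1%N a.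
  by rewrite Qt; ring.
by field; apply: Q0n0.
Qed.

(** The assumed quotient is the next term. At [qpoint] its product with a positive value is a square
    plus a product of positive values, whence its positivity. *)
Lemma qpolysS {r : nat} {K : numFieldType} (e : rel 'I_r) (N : nat)
    (F : nat -> 'I_r -> {mpoly K[(r + r)%N]}) :
  qpolys e N.+1 F ->
  (forall a, exists G, G * F N a = F N.+1 a ^+ 2
     - (1 - prev_var a * next_var a) * \prod_(b | e a b) F N.+1 b) ->
  exists F', qpolys e N.+2 F' /\ (forall m, (m <= N.+1)%N -> F' m = F m).
Proof.
move=> [F0 F1 Frec Fpos] /fin_all_exists [G HG].
pose F' m := if (m <= N.+1)%N then F m else G.
have F'E m : (m <= N.+1)%N -> F' m = F m by rewrite /F' => ->.
exists F'; split=> //.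
have F'rec : qsys_rel e (fun a => 1 - prev_var a * next_var a) N.+2 F'.
  move=> m a; rewrite ltnS ltnS leq_eqVlt => /orP[/eqP ->|lt_mN].
    by rewrite {1}/F' ltnn !F'E.
  have le_mN := ltnW lt_mN.
  by rewrite !F'E ?Frec //; apply: leqW.
split=> //.
move=> m a; rewrite leq_eqVlt => /orP[/eqP ->|lt_mN]; last by rewrite F'E ?Fpos.
have N1 b : 0 < (F' N.+1 b).@[qpoint] by rewrite F'E ?Fpos.
have N0 : 0 < (F' N a).@[qpoint] by rewrite F'E ?Fpos.
rewrite -(pmulr_lgt0 _ N0) -mevalM F'rec //.
rewrite mevalB rmorphXn !mevalM mevalB mevalM meval1 !mevalXU.
rewrite /qpoint split_lshift split_rshift rmorph_prod /= mulr1.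
have -> : 1 - 2 = -1 :> K by ring.
rewrite mulN1r opprK addr_gt0 ?exprn_gt0 //.
by apply: prodr_gt0 => b _; apply: N1.
Qed.

Lemma qpolys2E {r : nat} {K : numFieldType} (e : rel 'I_r) (N : nat)
    (F : nat -> 'I_r -> {mpoly K[(r + r)%N]}) : (1 < N)%N -> qpolys e N F ->
  forall a, F 2%N a = next_var a ^+ 2
    - (1 - prev_var a * next_var a) * \prod_(b | e a b) next_var b.
Proof.
move=> N1 [F0 F1 Frec _] a; rewrite -[LHS]mulr1 -[X in _ * X](F0 a) Frec // F1.
congr (_ - _ * _). by apply: eq_bigr => b _; rewrite F1.
Qed.

Lemma zero_next_prev {r : nat} {K : comNzRingType} (a b : 'I_r) :
  zero_var (rshift r a) (prev_var b : {mpoly K[(r + r)%N]}) = prev_var b.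
Proof. by rewrite /zero_var mmapX mmap1U eq_lrshift. Qed.

Lemma zero_next_next {r : nat} {K : comNzRingType} (a b : 'I_r) :
  zero_var (rshift r a) (next_var b : {mpoly K[(r + r)%N]})
    = if b == a then 0 else next_var b.
Proof. by rewrite /zero_var mmapX mmap1U eq_rshift. Qed.

(** Setting [v_a] to 0 kills the square and the t v term if [b] is [a], the product if [b] is a
    neighbour of [a], and nothing otherwise. *)
Lemma zero_next_qpolys2 {r : nat} {K : numFieldType} (e : rel 'I_r) (N : nat)
    (F : nat -> 'I_r -> {mpoly K[(r + r)%N]}) : ssrbool.symmetric e -> irreflexive e ->
  (1 < N)%N -> qpolys e N F -> forall a b,
  zero_var (rshift r a) (F 2%N b) =
    if b == a then - \prod_(b | e a b) next_var b
    else if e a b then next_var b ^+ 2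
    else next_var b ^+ 2
      - (1 - prev_var b * next_var b) * \prod_(d | e b d) next_var d.
Proof.
move=> esym eirr N1 HF a b; rewrite (qpolys2E _ _ _ N1 HF).
rewrite {1}/zero_var rmorphB rmorphXn rmorphM rmorphB rmorphM rmorph1 rmorph_prod /=.
rewrite -!/(zero_var _ _) !zero_next_prev !zero_next_next.
have [->|ba] := eqVneq b a.
  rewrite expr0n mulr0 subr0 mul1r sub0r; congr (- _); apply: eq_bigr => d ad.
  rewrite -/(zero_var _ _) zero_next_next; case: eqP => // da.
  by rewrite da eirr in ad.
case: ifP => ab.
  rewrite (bigD1 a) /=; last by rewrite esym.
  by rewrite -/(zero_var _ _) zero_next_next eqxx mul0r mulr0 subr0.
congr (_ - _ * _); apply: eq_bigr => d bd.
rewrite -/(zero_var _ _) zero_next_next; case: eqP => // da.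
by rewrite da esym ab in bd.
Qed.

(** At the point with all coordinates 1 the factor 1 - t v vanishes, and the three cases of the
    reduction take the values -1, 1 and 1. *)
Lemma zero_next_qpolys2_neq0 {r : nat} {K : numFieldType} (e : rel 'I_r) (N : nat)
    (F : nat -> 'I_r -> {mpoly K[(r + r)%N]}) : ssrbool.symmetric e -> irreflexive e ->
  (1 < N)%N -> qpolys e N F -> forall a b, zero_var (rshift r a) (F 2%N b) != 0.
Proof.
move=> esym eirr N1 HF a b; rewrite (zero_next_qpolys2 _ _ _ esym eirr N1 HF).
have Xv d : (next_var d : {mpoly K[(r + r)%N]}).@[fun=> 1] = 1.
  by rewrite mevalXU.
have Pv d : (\prod_(i | e d i) next_var i : {mpoly K[(r + r)%N]}).@[fun=> 1] = 1.
  by rewrite rmorph_prod big1 // => i _; apply: Xv.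
apply/negP => /eqP /(congr1 (meval (fun=> 1))); apply/eqP.
rewrite meval0; case: ifP => _; first by rewrite mevalN Pv oppr_eq0 oner_eq0.
case: ifP => _; first by rewrite rmorphXn /= Xv expr1n oner_eq0.
rewrite mevalB rmorphXn /= mevalM Pv mevalB mevalM !Xv meval1 mevalXU.
by rewrite expr1n !mulr1 subrr subr0 oner_eq0.
Qed.

Lemma qpolys_dvd {r : nat} {K : numFieldType} (e : rel 'I_r) (N : nat)
    (F : nat -> 'I_r -> {mpoly K[(r + r)%N]}) : ssrbool.symmetric e -> irreflexive e ->
  (0 < N)%N -> qpolys e N.+2 F -> forall a, exists G, G * F N.+1 a = F N.+2 a ^+ 2
     - (1 - prev_var a * next_var a) * \prod_(b | e a b) F N.+2 b.
Proof.
move=> esym eirr N_gt0 HF a; case: (HF) => F0 F1 Frec Fpos.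
pose G := {fraction {mpoly K[(r + r)%N]}}.
pose f (p : {mpoly K[(r + r)%N]}) : G := FracField.tofrac p.
have Fn0 m b : (m <= N.+2)%N -> f (F m b) != 0.
  move=> le_m; rewrite tofrac_eq0; apply/negP => /eqP F_0.
  by have := Fpos m b le_m; rewrite F_0 meval0 ltxx.
pose c b : G := f (1 - prev_var b * next_var b).
pose y b : G := (f (F N.+2 b) ^+ 2 - c b * \prod_(d | e b d) f (F N.+2 d)) / f (F N.+1 b).
(* The candidate fraction [y] continues the sequence at time [N.+3]; no later time is used. *)
pose Q m b := if (m <= N.+2)%N then f (F m b) else y b.
have QE m b : (m <= N.+2)%N -> Q m b = f (F m b) by rewrite /Q => ->.
have Qrec : qsys_rel e c N.+3 Q.
  move=> m b; rewrite !ltnS leq_eqVlt => /orP[/eqP ->|lt_mN].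
    rewrite {1}/Q ltnn !QE // divfK ?Fn0 //; congr (_ - _ * _).
    by apply: eq_bigr => d _; rewrite QE.
  have lt1 : (m.+1 < N.+2)%N := lt_mN.
  have lt2 := ltnW lt1; have lt3 := ltnW lt2.
  rewrite !QE // /f -tofracM Frec // tofracB tofracXn tofracM.
  rewrite rmorph_prod; congr (_ - _ * _); apply: eq_bigr => d _.
  by rewrite QE.
have Qn0 m b : (m < N.+3)%N -> Q m b != 0 by move=> lt_m; rewrite QE // Fn0.
suff [p yE] : integral (y a).
  exists p; apply/eqP; rewrite -tofrac_eq tofracM -yE divfK ?Fn0 //.
  by rewrite tofracB tofracXn tofracM rmorph_prod.
have int_f p : integral (f p) by exists p.
have F'S m : (m <= N.+2)%N -> qpolys e m F.
  move=> le_m; split=> // [k b lt_k|k b le_k]; [apply: Frec|apply: Fpos].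
    exact: leq_trans lt_k le_m.
  exact: leq_trans le_k le_m.
(* Restarting the recursion at time 1 leaves only powers of the Q_1 in the
   denominator, restarting it at time 2 only powers of the Q_2. *)
have den i : (0 < i <= 2)%N ->
    exists k, integral (f (\prod_b F i b) ^+ k * y a).
  case: i => // i /= lt_i.
  have lt_iN : (i.+1 <= N.+2)%N by apply: leq_trans lt_i _.
  (* The restart is now at time [i.+1]. The coordinates divide its two neighbours by it, so only the
     [F i.+1 b] are denominators; [0 < N] ensures that time [i.+2] is among the known
     polynomials. *)
  pose z (j : 'I_(r + r)) := match split j with
    | inl b => Q i b / Q i.+1 b | inr b => Q i.+2 b / Q i.+1 b end.
  have := @qsys_qpolys r K G (@FracField.tofrac _ \o @mpolyC _ K) e (N.+2 - i) F c
    (fun b => Q i b) (fun m => Q (m + i.+1)%N) z.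
  (* Counted from the restart, time [N.+3] is [N.+2 - i], for which [F] is already available. *)
  have -> : y a = Q (N.+2 - i + i.+1)%N a.
    by rewrite addnS subnK ?(ltnW lt_iN) // /Q ltnn.
  move=> -> //; last 7 first.
  - by apply: F'S; rewrite leq_subr.
  - move=> m b lt_m; rewrite !addSn; apply: Qrec.
    by move: lt_m lt_iN; clear; lia.
  - move=> m b lt_m; apply: Qn0.
    by move: lt_m lt_iN; clear; lia.
  - by move=> b; rewrite mulrC !add0n add1n Qrec // ltnS (leq_trans lt_i).
  - by move=> b; rewrite /z split_lshift.
  - by move=> b; rewrite /z split_rshift.
  - by rewrite subn_gt0.
  rewrite add0n.
  have prodE b : \prod_b F i.+1 b = F i.+1 b * \prod_(d | d != b) F i.+1 d.
    by rewrite (bigD1 b).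
  have [||k Hk] := @integral_mmap _ _ _ (@mpolyC _ K) (f (\prod_b F i.+1 b)) z
    (F (N.+2 - i)%N a).
  - exact: int_f.
  - move=> j; rewrite /z; case: (split j) => b; rewrite (prodE b) /f tofracM -/(f _);
    rewrite -!/(f _) !QE ?(ltnW lt_iN) //; last by move: lt_i N_gt0; clear; lia.
      by rewrite mulrC mulrA divfK ?Fn0 // -tofracM; apply: int_f.
    by rewrite mulrC mulrA divfK ?Fn0 // -tofracM; apply: int_f.
  exists k; rewrite mulrCA; apply: integralM Hk.
  by rewrite QE //; apply: int_f.
have [k1 H1] := den 1%N isT; have [k2 H2] := den 2%N isT.
(* The two denominators are coprime: modulo each [v_b] the second is a product of nonzero elements
   of a domain. *)
apply: (@integral_coprime_monomial _ _ _ (index_enum 'I_r) (@rshift r r) k1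
  ((\prod_b F 2%N b) ^+ k2)).
- move=> b; rewrite /zero_var rmorphXn expf_neq0 //= rmorph_prod.
  apply/prodf_neq0 => d _.
  by apply: zero_next_qpolys2_neq0 esym eirr _ HF b d.
- by move: H1; rewrite (eq_bigr _ (fun b _ => F1 b)).
- by rewrite tofracXn.
Qed.

(** Terms are added one at a time: F_2 needs a division by 1, F_3 a division by the variable [v_a],
    and from F_4 on [qpolys_dvd] applies. *)
Lemma qpolys_exist {r : nat} {K : numFieldType} (e : rel 'I_r) (N : nat) :
  ssrbool.symmetric e -> irreflexive e ->
  exists F : nat -> 'I_r -> {mpoly K[(r + r)%N]}, qpolys e N.+1 F.
Proof.
move=> esym eirr; elim: N => [|N [F HF]].
  (* With bound 1 the recursion is vacuous, so the values beyond time 1 are arbitrary. *)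
  exists (fun m a => if m is 0%N then 1 else next_var a); split=> //.
  case=> [|m] a _; first by rewrite meval1 ltr01.
  by rewrite mevalXU /qpoint split_rshift ltr01.
suff /(qpolysS _ _ _ HF) [F' [HF' _]] : forall a, exists G, G * F N a = F N.+1 a ^+ 2
     - (1 - prev_var a * next_var a) * \prod_(b | e a b) F N.+1 b by exists F'.
move=> a; case: N HF => [|[|N]] HF; last exact: qpolys_dvd HF a.
  by case: (HF) => F0 _ _ _; rewrite F0; eexists; rewrite mulr1.
case: (HF) => _ F1 _ _; rewrite F1.
(* Modulo [v_a] the factor 1 - t v becomes 1, F_{a,2} becomes minus the product of the neighbouring
   [v_b], and each neighbouring F_{b,2} becomes [v_b ^+ 2], so the difference cancels. *)
suff /zero_var_ker [q ->] : zero_var (rshift r a) (F 2%N a ^+ 2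
     - (1 - prev_var a * next_var a) * \prod_(b | e a b) F 2%N b) = 0.
  by exists q; rewrite mulrC.
rewrite {1}/zero_var rmorphB rmorphXn rmorphM rmorphB rmorphM rmorph1 rmorph_prod /=.
rewrite -!/(zero_var _ _) zero_next_next eqxx mulr0 subr0 mul1r.
rewrite (zero_next_qpolys2 _ _ _ esym eirr _ HF) // eqxx sqrrN -prodrXl.
apply/eqP; rewrite subr_eq0; apply/eqP/eq_bigr => b ab.
rewrite -/(zero_var _ _) (zero_next_qpolys2 _ _ _ esym eirr _ HF) // ab.
by case: eqP => // ba; rewrite ba eirr in ab.
Qed.

(** * Specialization to the Q-system *)

Lemma scalar_is_zmod_morphism {K : fieldType} {r : nat} :
  zmod_morphism (@Defs.scalar K r).
Proof. by move=> a b; rewrite /Defs.scalar mpolyCB tofracB. Qed.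

Lemma scalar_is_monoid_morphism {K : fieldType} {r : nat} :
  monoid_morphism (@Defs.scalar K r).
Proof.
by split=> [|a b]; rewrite /Defs.scalar ?mpolyC1 ?tofrac1 // mpolyCM tofracM.
Qed.

HB.instance Definition _ (K : fieldType) (r : nat) :=
  GRing.isZmodMorphism.Build K (ratfun K r) (@Defs.scalar K r) scalar_is_zmod_morphism.
HB.instance Definition _ (K : fieldType) (r : nat) :=
  GRing.isMonoidMorphism.Build K (ratfun K r) (@Defs.scalar K r) scalar_is_monoid_morphism.

Lemma indet_neq0 {K : fieldType} {r : nat} j : @indet K r j != 0.
Proof. by rewrite /indet tofrac_eq0 -msize_poly_eq0 msizeX. Qed.

Lemma scalar_neq0 {K : fieldType} {r : nat} c : c != 0 -> @Defs.scalar K r c != 0.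
Proof. by rewrite fmorph_eq0. Qed.

Lemma poly_eval_indet {K : fieldType} {r : nat} (p : {mpoly K[(r + r)%N]}) :
  poly_eval p (@indet K r) = FracField.tofrac p.
Proof.
elim/(@mpoly_ring_ind (r + r) K): p => [c|j|p q Hp Hq|p q Hp Hq].
- by rewrite /poly_eval mmapC.
- by rewrite /poly_eval mmapX mmap1U.
- by rewrite tofracD -Hp -Hq /poly_eval rmorphD.
- by rewrite tofracM -Hp -Hq /poly_eval rmorphM.
Qed.

Lemma Q_recS {K : fieldType} {r : nat} (C : 'M[int]_r) (m : nat) (a : 'I_r) :
  @Q K r C a m.+2 = (Q K C a m)^-1 *
    (Q K C a m.+1 ^+ 2 - \prod_(b | adjacent C a b) Q K C b m.+1).
Proof. by []. Qed.

(** The diagonal entry contributes [eps a ^+ 2] and each neighbour an inverse. The resulting sign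
    turns the subtraction in the recursion into an addition for [Qt]. *)
Lemma eps_prod_adjacent {K : fieldType} {r : nat} (C : 'M[int]_r) (eps : 'I_r -> K) :
  (forall a, C a a = 2) -> (forall a b, a != b -> C a b = 0 \/ C a b = -1) ->
  (forall a, eps a != 0) -> (forall a, \prod_(b < r) eps b ^ C a b = -1) ->
  forall a, \prod_(b | adjacent C a b) eps b = - eps a ^+ 2.
Proof.
move=> Cd Co e0 eP a; have := eP a; rewrite (bigD1 a) //= Cd.
have -> : \prod_(b | b != a) eps b ^ C a b = (\prod_(b | adjacent C a b) eps b)^-1.
  rewrite -prodfV [RHS]big_mkcondr /=; apply: eq_bigr => b ba.
  by case: (Co a b); rewrite 1?eq_sym // => ->.
move/eqP; rewrite -[eps a ^ 2]/(eps a ^+ 2) => /eqP H.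
have p0 : \prod_(b | adjacent C a b) eps b != 0 by apply/prodf_neq0.
by rewrite -[eps a ^+ 2](divfK p0) H mulN1r opprK.
Qed.

Lemma exchange_rescale {E : fieldType} (s x y p : E) : s != 0 ->
  s * (x^-1 * (y ^+ 2 - p)) = (s * x)^-1 * ((s * y) ^+ 2 + - s ^+ 2 * p).
(* [x] may be zero, so its inverse is generalized to an arbitrary element before [field]. *)
Proof. by move=> s0; rewrite invfM; move: x^-1 => xi; field. Qed.

Lemma Qt_rec {K : fieldType} {r : nat} (C : 'M[int]_r) (eps : 'I_r -> K)
    (x y : 'I_r -> ratfun K r) (a : 'I_r) :
  (forall a, eps a != 0) ->
  \prod_(b | adjacent C a b) eps b = - eps a ^+ 2 ->
  Defs.scalar r (eps a) * qsys_next C x y a = (Defs.scalar r (eps a) * x a)^-1 *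
    ((Defs.scalar r (eps a) * y a) ^+ 2
      + \prod_(b | adjacent C a b) (Defs.scalar r (eps b) * y b)).
Proof.
move=> e0 eP; rewrite /qsys_next big_split /= -rmorph_prod eP rmorphN rmorphXn /=.
by rewrite exchange_rescale // scalar_neq0.
Qed.

(** Positivity at [x] without evaluating fractions; the class is closed under sums, products and
    inverses and excludes 0. *)
Definition positive_at {n : nat} {K : numFieldType} (x : 'I_n -> K)
    (f : {fraction {mpoly K[n]}}) : Prop :=
  exists p d : {mpoly K[n]}, [/\ 0 < p.@[x], 0 < d.@[x]
    & f = FracField.tofrac p / FracField.tofrac d].

Lemma meval_gt0_neq0 {n : nat} {K : numFieldType} (x : 'I_n -> K)
    (d : {mpoly K[n]}) : 0 < d.@[x] -> FracField.tofrac d != 0.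
Proof.
by move=> d0; rewrite tofrac_eq0; apply: contraTneq d0 => ->; rewrite meval0 ltxx.
Qed.

Lemma positive_at_neq0 {n : nat} {K : numFieldType} (x : 'I_n -> K) f :
  positive_at x f -> f != 0.
Proof.
by case=> p [d [p0 d0 ->]]; rewrite mulf_neq0 ?invr_eq0 ?(@meval_gt0_neq0 n K x).
Qed.

Lemma positive_at1 {n : nat} {K : numFieldType} (x : 'I_n -> K) : positive_at x 1.
Proof. by exists 1, 1; rewrite meval1 ltr01 tofrac1 divr1. Qed.

Lemma positive_atM {n : nat} {K : numFieldType} (x : 'I_n -> K) f g :
  positive_at x f -> positive_at x g -> positive_at x (f * g).
Proof.
move=> [p [d [p0 d0 ->]]] [q [c [q0 c0 ->]]]; exists (p * q), (d * c).
by rewrite !mevalM !mulr_gt0 // !tofracM invfM mulrACA.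
Qed.

Lemma positive_atV {n : nat} {K : numFieldType} (x : 'I_n -> K) f :
  positive_at x f -> positive_at x f^-1.
Proof. by case=> p [d [p0 d0 ->]]; exists d, p; rewrite invf_div. Qed.

Lemma positive_atD {n : nat} {K : numFieldType} (x : 'I_n -> K) f g :
  positive_at x f -> positive_at x g -> positive_at x (f + g).
Proof.
move=> [p [d [p0 d0 ->]]] [q [c [q0 c0 ->]]]; exists (p * c + q * d), (d * c).
rewrite mevalD !mevalM addr_gt0 ?mulr_gt0 //; split=> //.
by rewrite addf_div ?(@meval_gt0_neq0 n K x) // !(tofracD, tofracM).
Qed.

(* The recursion for Qt has no subtraction, so Qt is positive at the point where
   all the Qt_{a,0} and Qt_{a,1} equal 1. *)
Lemma Q_neq0 {K : numFieldType} {r : nat} (C : 'M[int]_r) (eps : 'I_r -> K) :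
  (forall a, eps a != 0) ->
  (forall a, \prod_(b | adjacent C a b) eps b = - eps a ^+ 2) ->
  forall (m : nat) a, @Q K r C a m != 0.
Proof.
move=> e0 eP m a.
pose x j := (eps (match split j with inl b => b | inr b => b end))^-1.
suff H (k : nat) : (forall b, positive_at x (Qt C eps b k)) /\
           (forall b, positive_at x (Qt C eps b k.+1)).
  by have := positive_at_neq0 _ _ ((H m).1 a); apply: contraNneq; rewrite /Qt => ->; rewrite mulr0.
elim: k => [|k [IH0 IH1]]; split=> // b.
- exists ((eps b)%:MP * 'X_(lshift r b)), 1.
  rewrite meval1 ltr01 tofrac1 divr1 tofracM mevalM mevalC mevalXU.
  by rewrite /x split_lshift mulfV // ltr01.
- exists ((eps b)%:MP * 'X_(rshift r b)), 1.
  rewrite meval1 ltr01 tofrac1 divr1 tofracM mevalM mevalC mevalXU.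
  by rewrite /x split_rshift mulfV // ltr01.
rewrite /Qt Q_recS Qt_rec //.
apply: positive_atM; first by apply: positive_atV; apply: IH0.
apply: positive_atD; first by rewrite expr2; apply: positive_atM; apply: IH1.
apply: (big_ind (positive_at x)); first exact: positive_at1.
  exact: positive_atM.
by move=> d _; apply: IH1.
Qed.

(** * Limits of Laurent polynomials at Q_{a,0} = 1 *)

Definition poly_limit {K : fieldType} {r : nat} (C : 'M[int]_r) (eps : 'I_r -> K)
    (f : ratfun K r) : Prop :=
  exists p : {mpoly K[(r + r)%N]},
    Q0_limit f (poly_eval p (fun l => node0_limit C eps 0 l)).

Lemma mmap1M {F : comNzRingType} {n : nat} (h : 'I_n -> F) m1 m2 :
  mmap1 h (m1 + m2) = mmap1 h m1 * mmap1 h m2.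
Proof. by apply: commr_mmap1_M => i x; apply: mulrC. Qed.

Lemma mmap1_neq0 {F : fieldType} {n : nat} (h : 'I_n -> F) m :
  (forall j, h j != 0) -> mmap1 h m != 0.
Proof. by move=> h0; apply/prodf_neq0 => i _; apply: expf_neq0. Qed.

Lemma at_Q0_1_neq0 {K : fieldType} {r : nat} j : @at_Q0_1 K r j != 0.
Proof. by rewrite /at_Q0_1; case: split => a; rewrite ?oner_neq0 ?indet_neq0. Qed.

Lemma laurent_evalM {K : fieldType} {r : nat} P P' m m' (y : 'I_(r + r) -> ratfun K r) :
  laurent_eval P m y * laurent_eval P' m' y = laurent_eval (P * P') (m + m') y.
Proof. by rewrite /laurent_eval /poly_eval rmorphM mmap1M invfM mulrACA. Qed.

Lemma laurent_evalD {K : fieldType} {r : nat} P P' m m' (y : 'I_(r + r) -> ratfun K r) :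
  (forall j, y j != 0) -> laurent_eval P m y + laurent_eval P' m' y
    = laurent_eval (P * 'X_[m'] + P' * 'X_[m]) (m + m') y.
Proof.
move=> y0; rewrite /laurent_eval addf_div ?mmap1_neq0 //.
by rewrite /poly_eval rmorphD !rmorphM /= !mmapX mmap1M.
Qed.

Lemma Q0_limitM {K : fieldType} {r : nat} (f f1 g g1 : ratfun K r) :
  Q0_limit f f1 -> Q0_limit g g1 -> Q0_limit (f * g) (f1 * g1).
Proof.
move=> [P [m [-> ->]]] [P' [m' [-> ->]]].
by exists (P * P'), (m + m')%MM; rewrite !laurent_evalM.
Qed.

(** One common denominator serves for the sum and for its limit, because no coordinate of [indet] or
    [at_Q0_1] vanishes. *)
Lemma Q0_limitD {K : fieldType} {r : nat} (f f1 g g1 : ratfun K r) :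
  Q0_limit f f1 -> Q0_limit g g1 -> Q0_limit (f + g) (f1 + g1).
Proof.
move=> [P [m [-> ->]]] [P' [m' [-> ->]]].
exists (P * 'X_[m'] + P' * 'X_[m]), (m + m')%MM.
by rewrite !laurent_evalD //; [apply: at_Q0_1_neq0|apply: indet_neq0].
Qed.

Lemma Q0_limit_poly {K : fieldType} {r : nat} (P : {mpoly K[(r + r)%N]}) :
  Q0_limit (poly_eval P (@indet K r)) (poly_eval P (@at_Q0_1 K r)).
Proof. by exists P, 0%MM; rewrite /laurent_eval !mmap11 !divr1. Qed.

Lemma Q0_limitV {K : fieldType} {r : nat} j :
  Q0_limit (@indet K r j)^-1 (@at_Q0_1 K r j)^-1.
Proof.
by exists 1, U_(j)%MM; rewrite /laurent_eval !mmap1U /poly_eval !rmorph1 !mul1r.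
Qed.

Lemma poly_limitM {K : fieldType} {r : nat} (C : 'M[int]_r) (eps : 'I_r -> K) f g :
  poly_limit C eps f -> poly_limit C eps g -> poly_limit C eps (f * g).
Proof.
move=> [p Hp] [q Hq]; exists (p * q); rewrite /poly_eval rmorphM.
exact: Q0_limitM.
Qed.

Lemma poly_limitD {K : fieldType} {r : nat} (C : 'M[int]_r) (eps : 'I_r -> K) f g :
  poly_limit C eps f -> poly_limit C eps g -> poly_limit C eps (f + g).
Proof.
move=> [p Hp] [q Hq]; exists (p + q); rewrite /poly_eval rmorphD.
exact: Q0_limitD.
Qed.

Lemma poly_limit_scalar {K : fieldType} {r : nat} (C : 'M[int]_r) (eps : 'I_r -> K) c :
  poly_limit C eps (Defs.scalar r c).
Proof.
by exists c%:MP; have := @Q0_limit_poly K r c%:MP; rewrite /poly_eval !mmapC.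
Qed.

Lemma poly_limit_mmap {K : fieldType} {r n : nat} (C : 'M[int]_r) (eps : 'I_r -> K)
    (z : 'I_n -> ratfun K r) (p : {mpoly K[n]}) :
  (forall j, poly_limit C eps (z j)) -> poly_limit C eps (mmap (@Defs.scalar K r) z p).
Proof.
move=> Hz; elim/(@mpoly_ring_ind n K): p => [c|j|p q Hp Hq|p q Hp Hq].
- by rewrite mmapC; apply: poly_limit_scalar.
- by rewrite mmapX mmap1U.
- by rewrite rmorphD; apply: poly_limitD.
- by rewrite rmorphM; apply: poly_limitM.
Qed.

Lemma poly_limit0 {K : fieldType} {r : nat} (C : 'M[int]_r) (eps : 'I_r -> K) a :
  poly_limit C eps (indet0 K a) /\ poly_limit C eps (indet0 K a)^-1.
Proof.
split; exists 1; rewrite /poly_eval rmorph1.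
  have := @Q0_limit_poly K r 'X_(lshift r a).
  by rewrite /poly_eval !mmapX !mmap1U /at_Q0_1 split_lshift.
by have := @Q0_limitV K r (lshift r a); rewrite /at_Q0_1 split_lshift invr1.
Qed.

Lemma poly_limit1 {K : fieldType} {r : nat} (C : 'M[int]_r) (eps : 'I_r -> K) a :
  eps a != 0 -> poly_limit C eps (indet1 K a).
Proof.
move=> e0; exists ((eps a)^-1%:MP * 'X_(rshift r a)).
rewrite /poly_eval rmorphM /= mmapC mmapX mmap1U /node0_limit row_mxEr mxE /Qt.
rewrite mulrA -rmorphM mulVf // rmorph1 mul1r.
have := @Q0_limit_poly K r 'X_(rshift r a).
by rewrite /poly_eval !mmapX !mmap1U /at_Q0_1 split_rshift.
Qed.

(* In the limit the numerator 1 - 1 vanishes. *)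
Lemma poly_limit_prev {K : fieldType} {r : nat} (C : 'M[int]_r) (eps : 'I_r -> K) a :
  poly_limit C eps
    ((indet0 K a ^+ 2 - \prod_(b | adjacent C a b) indet0 K b) / indet1 K a).
Proof.
exists 0; rewrite /poly_eval rmorph0.
rewrite -[X in Q0_limit _ X](mul0r (@at_Q0_1 K r (rshift r a))^-1).
apply: Q0_limitM (Q0_limitV _).
have := @Q0_limit_poly K r ('X_(lshift r a) ^+ 2 - \prod_(b | adjacent C a b) 'X_(lshift r b)).
rewrite poly_eval_indet tofracB tofracXn rmorph_prod /=.
rewrite /poly_eval rmorphB rmorphXn /= mmapX mmap1U rmorph_prod /= [\prod_(b | _) mmap _ _ _]big1.
  by rewrite /at_Q0_1 split_lshift expr1n subrr.
by move=> b _; rewrite mmapX mmap1U /at_Q0_1 split_lshift.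
Qed.

(** The universal solution is used with constant 1. Its arguments contain inverses of Q_{b,0}, whose
    limit is 1, and of Q_{b,1}, which only occur next to a numerator of limit 0. *)
Lemma poly_limit_Qt {K : numFieldType} {r : nat} (C : 'M[int]_r) (eps : 'I_r -> K) :
  C^T = C -> (forall a, eps a != 0) ->
  (forall a, \prod_(b | adjacent C a b) eps b = - eps a ^+ 2) ->
  forall (m : nat) a, poly_limit C eps (Qt C eps a m).
Proof.
move=> CT e0 eP m a; rewrite /Qt.
have Q0 := Q_neq0 C eps e0 eP.
have esym : ssrbool.symmetric (adjacent C).
  by move=> b d; rewrite /adjacent eq_sym -{1}CT mxE.
have eirr : irreflexive (adjacent C) by move=> b; rewrite /adjacent eqxx.
have [F HF] := @qpolys_exist r K (adjacent C) m esym eirr.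
(* This is Q_{b,-1}, solved from the recursion at time 0. *)
pose t b : ratfun K r :=
  (indet0 K b ^+ 2 - \prod_(d | adjacent C b d) indet0 K d) / indet1 K b.
pose z (j : 'I_(r + r)) : ratfun K r := match split j with
  | inl b => t b / indet0 K b | inr b => indet1 K b / indet0 K b end.
apply: poly_limitM; first exact: poly_limit_scalar.
have := @qsys_qpolys r K _ (@Defs.scalar K r) (adjacent C) m.+1 F (fun=> 1) t
  (fun k b => Q K C b k) z HF.
move=> -> //.
- apply: poly_limitM; first by have [] := poly_limit0 C eps a.
  apply: poly_limit_mmap => j; rewrite /z; case: split => b;
    apply: poly_limitM; try by have [] := poly_limit0 C eps b.
    exact: poly_limit_prev.
  exact: poly_limit1.
- by move=> k b _; rewrite Q_recS mul1r mulrC mulVKf ?Q0.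
- by move=> k b _; apply: Q0.
- by move=> b; rewrite mul1r /t divfK // indet_neq0.
- by move=> b; rewrite /z split_lshift.
- by move=> b; rewrite /z split_rshift.
Qed.

(** * Mutations *)

(** The nodes of [s] are pairwise unconnected. When the turn of [l] comes, row and column [l] of the
    matrix are still the original ones and the variables already exchanged have exponent 0 at [l],
    so every exchange can be read off the original seed. *)
Lemma foldl_mutate_independent {F : fieldType} {n : nat} (x : 'rV[F]_n)
    (B : 'M[int]_n) (s : seq 'I_n) :
  uniq s -> (forall i j, i \in s -> j \in s -> B i j = 0) ->
  foldl (@mutate F n) (x, B) s =
    (\row_j (if j \in s then mutate_cluster j B x 0 j else x 0 j),
     \matrix_(i, j) (if (i \in s) || (j \in s) then - B i j
       else B i j + \sum_(l <- s) Num.sg (B i l) * Num.max 0 (B i l * B l j))).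
Proof.
elim/last_ind: s => [|s l IHs] us B0.
  congr (_, _); first by apply/rowP => j; rewrite !mxE in_nil.
  by apply/matrixP => i j; rewrite !mxE big_nil addr0.
move: us; rewrite rcons_uniq => /andP[ls us].
have Bs i j : i \in s -> j \in s -> B i j = 0.
  by move=> si sj; apply: B0; rewrite mem_rcons inE ?si ?sj orbT.
have Bl i : i \in s -> B i l = 0.
  by move=> si; apply: B0; rewrite mem_rcons inE ?si ?eqxx ?orbT.
have lB i : i \in s -> B l i = 0.
  by move=> si; apply: B0; rewrite mem_rcons inE ?si ?eqxx ?orbT.
rewrite foldl_rcons {}IHs // /mutate; set x' := \row_j _; set B' := matrix_of_fun _ _.
have x'E j : x' 0 j = if j \in s then mutate_cluster j B x 0 j else x 0 j.
  by rewrite mxE.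
have B'E i j : B' i j = if (i \in s) || (j \in s) then - B i j
    else B i j + \sum_(k <- s) Num.sg (B i k) * Num.max 0 (B i k * B k j).
  by rewrite mxE.
clearbody x' B'.
have B'l i : B' i l = B i l.
  rewrite B'E (negPf ls) orbF; case: ifP => [si|_]; first by rewrite Bl // oppr0.
  rewrite big_seq big1 ?addr0 // => k sk.
  by rewrite Bl // mulr0 maxxx mulr0.
have lB' i : B' l i = B l i.
  rewrite B'E (negPf ls) /=; case: ifP => [si|_]; first by rewrite lB // oppr0.
  rewrite big_seq big1 ?addr0 // => k sk.
  by rewrite lB // sgr0 mul0r.
have x'B i z : z = B i l \/ z = - B i l ->
    x' 0 i ^+ pos_part z = x 0 i ^+ pos_part z.
  rewrite x'E; case: ifP => // si; rewrite Bl // oppr0.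
  by case=> ->; rewrite !expr0.
rewrite /=; congr (_, _).
  apply/rowP => j; rewrite [LHS]mxE [RHS]mxE mem_rcons inE.
  case: eqP => [->|_] /=; last exact: x'E.
  rewrite mxE eqxx x'E (negPf ls); congr (_ * (_ + _));
    by apply: eq_bigr => i _; rewrite B'l x'B; auto.
apply/matrixP => i j; rewrite [LHS]mxE [RHS]mxE !mem_rcons !inE B'l lB'.
have [->|il] := eqVneq i l; first by rewrite lB'.
have [->|jl] := eqVneq j l; first by rewrite ?orbT /= ?orbT B'l.
rewrite /= B'E; case: ifP => [/orP[si|sj]|_].
- by rewrite Bl // sgr0 mul0r addr0.
- by rewrite lB // mulr0 maxxx mulr0 addr0.
by rewrite big_rcons /= -addrA [X in _ + X]addrC.
Qed.

(** * Mutation at a whole block of a bipartite seed *)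

Definition bipartite {r : nat} (D : 'M[int]_r) : 'M[int]_(r + r) :=
  block_mx 0 (- D) D 0.

(* No arrows are created between the nodes of one block by mutating at all the
   nodes of the other. *)
Definition balanced {r : nat} (D : 'M[int]_r) : Prop :=
  forall i j, \sum_l Num.sg (D i l) * Num.max 0 (- (D i l * D l j)) = 0.

Lemma balancedN {r : nat} (D : 'M[int]_r) : balanced D -> balanced (- D).
Proof.
move=> HD i j; rewrite -[RHS]oppr0 -[in RHS](HD i j) -sumrN; apply: eq_bigr => l _.
by rewrite !mxE sgrN mulrNN mulNr.
Qed.

(** A term vanishes when [C i l * C l j] is nonnegative: always if [i = j], by symmetry, and
    otherwise for [l] distinct from [i] and [j]. The terms [l = i] and [l = j] that remain are 2 and
    -2 for neighbours, and 0 otherwise. *)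
Lemma balanced_cartan {r : nat} (C : 'M[int]_r) :
  C^T = C -> (forall a, C a a = 2) -> (forall a b, a != b -> C a b = 0 \/ C a b = -1) ->
  balanced C.
Proof.
move=> CT Cd Co i j.
have Cs a b : C a b = C b a by rewrite -{1}CT mxE.
have H l : l != i -> l != j -> Num.sg (C i l) * Num.max 0 (- (C i l * C l j)) = 0.
  move=> li lj; case: (Co i l); rewrite 1?eq_sym // => ->; first by rewrite sgr0 mul0r.
  by case: (Co l j) => // ->; rewrite ?mulr0 ?mulrNN.
have [<-|ij] := eqVneq i j.
  apply: big1 => l _; rewrite (Cs l i).
  by rewrite max_l ?mulr0 // oppr_le0 -expr2 sqr_ge0.
rewrite (bigD1 i) //= (bigD1 j) /= 1?eq_sym // big1 => [|l /andP[li lj]]; last exact: H.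
by rewrite !Cd; case: (Co i j ij) => ->; rewrite ?mul0r ?mulr0.
Qed.

Definition block_nodes0 (r : nat) : seq 'I_(r + r) := [seq lshift r a | a <- enum 'I_r].
Definition block_nodes1 (r : nat) : seq 'I_(r + r) := [seq rshift r a | a <- enum 'I_r].

Lemma mem_block_nodes0 {r : nat} (a : 'I_r) :
  (lshift r a \in block_nodes0 r) * (rshift r a \in block_nodes0 r = false).
Proof.
split; first by apply: map_f; rewrite mem_enum.
by apply/mapP => -[b _ /eqP]; rewrite eq_rlshift.
Qed.

Lemma mem_block_nodes1 {r : nat} (a : 'I_r) :
  (rshift r a \in block_nodes1 r) * (lshift r a \in block_nodes1 r = false).
Proof.
split; first by apply: map_f; rewrite mem_enum.
by apply/mapP => -[b _ /eqP]; rewrite eq_lrshift.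
Qed.

(** Numerator of the exchange relation at a node of one block, [y] being the variables of the
    other. *)
Definition block_exchange {F : fieldType} {r : nat} (D : 'M[int]_r)
    (y : 'rV[F]_r) (a : 'I_r) : F :=
  \prod_i y 0 i ^+ pos_part (D i a) + \prod_i y 0 i ^+ pos_part (- D i a).

Lemma block_exchangeN {F : fieldType} {r : nat} (D : 'M[int]_r) (y : 'rV[F]_r) a :
  block_exchange (- D) y a = block_exchange D y a.
Proof.
rewrite /block_exchange addrC; congr (_ + _); apply: eq_bigr => i _.
  by rewrite mxE opprK.
by rewrite mxE.
Qed.

(** New arrows could only appear between the untouched nodes, where the added sum is the one that
    [balanced] makes zero. *)
Lemma foldl_mutate_block0 {F : fieldType} {r : nat} (x y : 'rV[F]_r) (D : 'M[int]_r) :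
  balanced D -> foldl (@mutate F (r + r)) (row_mx x y, bipartite D) (block_nodes0 r)
    = (row_mx (\row_a ((x 0 a)^-1 * block_exchange D y a)) y, bipartite (- D)).
Proof.
move=> HD; rewrite foldl_mutate_independent; last 2 first.
- by rewrite map_inj_uniq ?enum_uniq //; apply: lshift_inj.
- by move=> _ _ /mapP[a _ ->] /mapP[b _ ->]; rewrite block_mxEul mxE.
congr (_, _).
  apply/rowP => j; rewrite mxE; case: (split_ordP j) => a ->; rewrite mem_block_nodes0.
    rewrite mxE eqxx !row_mxEl mxE; congr (_ * (_ + _));
    rewrite big_split_ord /= big1 ?mul1r => [|i _]; rewrite ?block_mxEul ?mxE ?oppr0 //.
      by apply: eq_bigr => i _; rewrite row_mxEr block_mxEdl.
    by apply: eq_bigr => i _; rewrite row_mxEr block_mxEdl.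
  by rewrite !row_mxEr.
apply/matrixP => i j; rewrite mxE.
case: (split_ordP i) => a ->; case: (split_ordP j) => b ->; rewrite !mem_block_nodes0 /=.
- by rewrite !block_mxEul mxE oppr0.
- by rewrite !block_mxEur !mxE.
- by rewrite !block_mxEdl mxE.
rewrite !block_mxEdr mxE add0r big_map big_enum /= -[RHS](HD a b).
by apply: eq_bigr => l _; rewrite block_mxEdl block_mxEur mxE mulrN.
Qed.

Lemma foldl_mutate_block1 {F : fieldType} {r : nat} (x y : 'rV[F]_r) (D : 'M[int]_r) :
  balanced D -> foldl (@mutate F (r + r)) (row_mx x y, bipartite D) (block_nodes1 r)
    = (row_mx x (\row_a ((y 0 a)^-1 * block_exchange D x a)), bipartite (- D)).
Proof.
move=> HD; rewrite foldl_mutate_independent; last 2 first.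
- by rewrite map_inj_uniq ?enum_uniq //; apply: rshift_inj.
- by move=> _ _ /mapP[a _ ->] /mapP[b _ ->]; rewrite block_mxEdr mxE.
congr (_, _).
  apply/rowP => j; rewrite mxE; case: (split_ordP j) => a ->; rewrite mem_block_nodes1.
    by rewrite !row_mxEl.
  rewrite mxE eqxx !row_mxEr mxE -(block_exchangeN D); congr (_ * (_ + _));
  rewrite big_split_ord /= mulrC big1 ?mul1r => [|i _]; rewrite ?block_mxEdr ?mxE ?oppr0 //.
    by apply: eq_bigr => i _; rewrite row_mxEl block_mxEur.
  by apply: eq_bigr => i _; rewrite row_mxEl block_mxEur.
apply/matrixP => i j; rewrite mxE.
case: (split_ordP i) => a ->; case: (split_ordP j) => b ->; rewrite !mem_block_nodes1 /=.
- rewrite !block_mxEul mxE add0r big_map big_enum /= -[RHS](balancedN D HD a b).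
  by apply: eq_bigr => l _; rewrite block_mxEdl block_mxEur !mxE mulrNN mulNr.
- by rewrite !block_mxEur !mxE.
- by rewrite !block_mxEdl mxE.
by rewrite !block_mxEdr mxE oppr0.
Qed.

(** In column [a] the only positive entry is the diagonal 2, and the negative entries are the -1 at
    the neighbours. *)
Lemma block_exchange_cartan {F : fieldType} {r : nat} (C : 'M[int]_r) (y : 'rV[F]_r) a :
  C^T = C -> (forall a, C a a = 2) -> (forall a b, a != b -> C a b = 0 \/ C a b = -1) ->
  block_exchange C y a = y 0 a ^+ 2 + \prod_(b | adjacent C a b) y 0 b.
Proof.
move=> CT Cd Co; rewrite /block_exchange (bigD1 a) //= Cd big1 ?mulr1 => [|i ia].
  congr (_ + _); rewrite (bigD1 a) //= Cd expr0 mul1r [RHS]big_mkcondr.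
  apply: eq_bigr => i ia; rewrite -{1}CT mxE.
  by case: (Co a i); rewrite 1?eq_sym // => ->.
by case: (Co i a ia) => ->.
Qed.

(** * Nodes of the Q-system as clusters *)

Lemma Qt_fwd {K : fieldType} {r : nat} (C : 'M[int]_r) (eps : 'I_r -> K) :
  (forall a, eps a != 0) ->
  (forall a, \prod_(b | adjacent C a b) eps b = - eps a ^+ 2) ->
  forall (m : nat) a, Qt C eps a m.+2 = (Qt C eps a m)^-1 *
    (Qt C eps a m.+1 ^+ 2 + \prod_(b | adjacent C a b) Qt C eps b m.+1).
Proof. by move=> e0 eP m a; rewrite {1}/Qt Q_recS Qt_rec. Qed.

Lemma Qt_bwd {K : fieldType} {r : nat} (C : 'M[int]_r) (eps : 'I_r -> K) :
  (forall a, eps a != 0) ->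
  (forall a, \prod_(b | adjacent C a b) eps b = - eps a ^+ 2) ->
  forall (m : nat) a, Qt C eps a (Negz m) = (Qt C eps a (1 - m%:Z))^-1 *
    (Qt C eps a (- m%:Z) ^+ 2 + \prod_(b | adjacent C a b) Qt C eps b (- m%:Z)).
Proof.
(* The cases m = 0, m = 1 and m > 1 differ in which of 1 - m and -m are [Posz] or [Negz]; in each,
   unfolding leaves [Qt_rec]. *)
move=> e0 eP m a; rewrite {1}/Qt; case: m => [|m]; first exact: Qt_rec.
rewrite -NegzE; have -> : 1 - m.+1%:Z = - m%:Z by lia.
by case: m => [|m]; rewrite -?NegzE; apply: Qt_rec.
Qed.

(** Mutating the first block takes times (2k, 2k+1) to (2k+2, 2k+1), and the second block then gives
    (2k+2, 2k+3); the matrix changes sign twice. Backwards, the second block comes first. *)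
Lemma node_is_cluster {K : fieldType} {r : nat} (C : 'M[int]_r) (eps : 'I_r -> K) :
  C^T = C -> (forall a, C a a = 2) -> (forall a b, a != b -> C a b = 0 \/ C a b = -1) ->
  (forall a, eps a != 0) ->
  (forall a, \prod_(b | adjacent C a b) eps b = - eps a ^+ 2) ->
  forall k : int, is_cluster (initial_seed C eps) (node C eps k).
Proof.
move=> CT Cd Co e0 eP.
have HC := balanced_cartan C CT Cd Co; have HN := balancedN C HC.
pose q k := \row_a Qt C eps a k.
have fwd (m : nat) D : D = C \/ D = - C ->
    \row_a ((q m 0 a)^-1 * block_exchange D (q m.+1) a) = q m.+2.
  move=> HD; apply/rowP => a; rewrite !mxE Qt_fwd //.
  have -> : block_exchange D (q m.+1) a = block_exchange C (q m.+1) a.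
    by case: HD => ->; rewrite ?block_exchangeN.
  rewrite block_exchange_cartan // mxE; congr (_ * (_ + _)).
  by apply: eq_bigr => b _; rewrite mxE.
have bwd (m : nat) D : D = C \/ D = - C ->
    \row_a ((q (1 - m%:Z) 0 a)^-1 * block_exchange D (q (- m%:Z)) a) = q (- m.+1%:Z).
  move=> HD; apply/rowP => a; rewrite -NegzE !mxE Qt_bwd //.
  have -> : block_exchange D (q (- m%:Z)) a = block_exchange C (q (- m%:Z)) a.
    by case: HD => ->; rewrite ?block_exchangeN.
  rewrite block_exchange_cartan // mxE; congr (_ * (_ + _)).
  by apply: eq_bigr => b _; rewrite mxE.
have nodeE k : node C eps k = row_mx (q (k *+ 2)) (q (k *+ 2 + 1)) by [].
suff H (m : nat) :
    (exists w, foldl (@mutate _ _) (initial_seed C eps) w = (node C eps m, bipartite C))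
    /\ (exists w, foldl (@mutate _ _) (initial_seed C eps) w
                    = (node C eps (- m%:Z), bipartite C)).
  by case=> m; [case: (H m) => [[w Hw] _]|case: (H m.+1) => [_ [w Hw]]];
    exists w; rewrite Hw.
elim: m => [|m [[w Hw] [w' Hw']]].
  by split; exists [::].
split.
- exists (w ++ (block_nodes0 r ++ block_nodes1 r)); rewrite !foldl_cat Hw !nodeE.
  have -> : m%:Z *+ 2 = (m + m)%N by lia.
  have -> : m.+1%:Z *+ 2 = (m + m).+2 by lia.
  have -> : (m + m)%N%:Z + 1 = (m + m).+1 by lia.
  have -> : (m + m).+2%:Z + 1 = (m + m).+3 by lia.
  by rewrite foldl_mutate_block0 // fwd ?foldl_mutate_block1 ?fwd ?opprK; auto.
- exists (w' ++ (block_nodes1 r ++ block_nodes0 r)); rewrite !foldl_cat Hw' !nodeE.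
  have -> : - m%:Z *+ 2 + 1 = 1 - (m + m)%N%:Z by lia.
  have -> : - m%:Z *+ 2 = - (m + m)%N%:Z by lia.
  have -> : - m.+1%:Z *+ 2 + 1 = - (m + m).+1%:Z by lia.
  have -> : - m.+1%:Z *+ 2 = - (m + m).+2%:Z by lia.
  rewrite foldl_mutate_block1 // bwd; auto.
  have -> : - (m + m)%N%:Z = 1 - (m + m).+1%:Z by lia.
  by rewrite foldl_mutate_block0 // bwd ?opprK; auto.
Qed.

Theorem theorem3p12 (R : realType) (r : nat)
    (g : vectType R[i]) (br : g -> g -> g) (C : 'M[int]_r) (eps : 'I_r -> R[i])
    (br_lie : lie_bracket br) (g_simple : simple_lie br)
    (C_cartan : cartan_matrix br C) (C_simply_laced : simply_laced C)
    (eps_neq0 : forall a, eps a != 0)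
    (eps_prod : forall a, \prod_(b < r) eps b ^ C a b = -1) :
  [/\ forall k : int, is_cluster (initial_seed C eps) (node C eps k),
      forall j, Q0_limit (node C eps 0 0 j) (node0_limit C eps 0 j)
    & forall k : int, 0 < k -> forall j : 'I_(r + r),
        exists p : {mpoly R[i][(r + r)%N]},
          Q0_limit (node C eps k 0 j)
            (poly_eval p (fun l => node0_limit C eps 0 l))].
Proof.
have [CT Co] := C_simply_laced.
(* A root takes the value 2 on its coroot, and integers embed in the complex numbers. *)
have Cd a : C a a = 2.
  have [H [alpha [h [_ _ hco hC]]]] := C_cartan.
  have [h2 _] := hco a; apply: (@intr_inj R[i]).
  by rewrite -hC h2.
have eP := eps_prod_adjacent C eps Cd Co eps_neq0 eps_prod.
split; first exact: node_is_cluster.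
- move=> j; rewrite /node /node0_limit.
  case: (split_ordP j) => a ->; rewrite ?row_mxEl ?row_mxEr !mxE /Qt.
    have := @Q0_limit_poly R[i] r ((eps a)%:MP * 'X_(lshift r a)).
    by rewrite /poly_eval !rmorphM /= !mmapC !mmapX !mmap1U /at_Q0_1 split_lshift mulr1.
  have := @Q0_limit_poly R[i] r ((eps a)%:MP * 'X_(rshift r a)).
  by rewrite /poly_eval !rmorphM /= !mmapC !mmapX !mmap1U /at_Q0_1 split_rshift.
case=> // m _ j; rewrite /node; case: (split_ordP j) => a ->.
  rewrite row_mxEl mxE; have -> : m%:Z *+ 2 = (m + m)%N by lia.
  exact: poly_limit_Qt.
rewrite row_mxEr mxE; have -> : m%:Z *+ 2 + 1 = (m + m).+1 by lia.
exact: poly_limit_Qt.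
Qed.
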